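(* Let $n\ge 1$ and $c\ge 1$ be integers and let $k$ be a non-negative integer. Then the number of colored Lehmer codes $\ell=(\ell_1,\dots,\ell_n)$ with $0\le \ell_i< c\cdot i$ for all $i$ and $\ell_1+\cdots+\ell_n=k$ equals $i_c(n,k)$.
   Context: For integers $n\ge1$, $c\ge1$, let $G_{c,n}$ be the set of colored permutations: words $\sigma=\sigma_1^{[c_1]}\sigma_2^{[c_2]}\cdots\sigma_n^{[c_n]}$ where $|\sigma|:=\sigma_1\sigma_2\cdots\sigma_n$ is a permutation of $[n]=\{1,\dots,n\}$ (the underlying permutation) and each color $c_i=\mathrm{col}(\sigma_i)\in\{0,1,\dots,c-1\}$; thus $|G_{c,n}|=c^n n!$. For a permutation $\pi$ of $[n]$, $\mathrm{inv}(\pi)=|\{(i,j):i<j,\ \pi_i>\pi_j\}|$. Set $\mathrm{col}(\sigma)=c_1+\cdots+c_n$ and define the colored inversion number $\mathrm{inv}_c(\sigma)=\mathrm{inv}(|\sigma|)+\mathrm{col}(\sigma)+c\cdot|\{(i,j):1\le i<j\le n,\ \sigma_i<\sigma_j,\ c_j\neq 0\}|$. The colored Mahonian number is $i_c(n,k)=|\{\sigma\in G_{c,n}:\mathrm{inv}_c(\sigma)=k\}|$. A colored Lehmer code of length $n$ (with parameter $c$) is an $n$-tuple of integers $(\ell_1,\dots,\ell_n)$ with $0\le\ell_i<c\cdot i$ for each $i$. *)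

(* Defs.v *)
From mathcomp Require Import all_boot all_fingroup.

Set Implicit Arguments.
Unset Strict Implicit.
Unset Printing Implicit Defensive.

(* Positions and values are indexed from 0, i.e. [n] is shifted to 'I_n. *)

(* A colored word is its underlying permutation |sigma| together with the
   assignment of a color to each position (not to each value). *)
Definition colored_perm (c n : nat) : finType :=
  ('S_n * {ffun 'I_n -> 'I_c})%type.

Definition underlying c n (s : colored_perm c n) : 'S_n := s.1.

Definition color c n (s : colored_perm c n) (i : 'I_n) : nat := s.2 i.

Definition perm_inv n (p : 'S_n) : nat :=
  #|[set ij : 'I_n * 'I_n | (ij.1 < ij.2) && (p ij.2 < p ij.1)]|.

Definition color_sum c n (s : colored_perm c n) : nat := \sum_(i < n) color s i.

(* The comparison sigma_i < sigma_j is between the underlying values. *)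
Definition inv_c c n (s : colored_perm c n) : nat :=
  perm_inv (underlying s) + color_sum s
  + c * #|[set ij : 'I_n * 'I_n |
            [&& ij.1 < ij.2, underlying s ij.1 < underlying s ij.2
              & color s ij.2 != 0]]|.

Definition colored_mahonian (c n k : nat) : nat :=
  #|[set s : colored_perm c n | inv_c s == k]|.

(* The entry at 0-based position i is the (i+1)-st one, so it is bounded by
   c * (i + 1). *)
Definition lehmer_code (c n : nat) : finType :=
  {dffun forall i : 'I_n, 'I_(c * i.+1)}.

Definition code_sum c n (l : lehmer_code c n) : nat := \sum_(i < n) l i.

(* Main.v *)
(** Position j (0-based) with color d, preceded by a smaller values, contributes
    (j - a) + d + c * a * [d <> 0] to inv_c.  As (a, d) ranges over
    {0..j} x {0..c-1}, this digit takes each value in {0..c(j+1)-1} exactly once: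
    d = 0 gives 0..j, and d > 0 gives j + (c-1) a + d, that is j+1..c(j+1)-1 in
    base c-1.  As the counts a determine the permutation, mapping a colored
    permutation to its digits is a bijection onto Lehmer codes turning inv_c
    into the sum. *)
Require Import Defs.
From mathcomp Require Import all_boot all_fingroup.
From mathcomp Require Import zify.

Set Implicit Arguments.
Unset Strict Implicit.
Unset Printing Implicit Defensive.

Definition smaller_before n (p : 'S_n) (j : 'I_n) : nat :=
  #|[set i : 'I_n | (i < j) && (p i < p j)]|.

Lemma card_ord_lt n (j : 'I_n) : #|[set i : 'I_n | i < j]| = j.
Proof.
rewrite -sum1dep_card -(big_ord_widen n (fun _ => 1)) ?sum1_card ?card_ord //.
exact: ltnW.
Qed.

Lemma smaller_before_le n (p : 'S_n) (j : 'I_n) : smaller_before p j <= j.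
Proof.
rewrite -[leqRHS]card_ord_lt; apply: subset_leq_card.
by apply/subsetP => i; rewrite !inE => /andP[].
Qed.

Lemma card_larger_before n (p : 'S_n) (j : 'I_n) :
  #|[set i : 'I_n | (i < j) && (p j < p i)]| = j - smaller_before p j.
Proof.
rewrite -[X in X - _](card_ord_lt j).
rewrite -(cardsID [set i : 'I_n | p i < p j] [set i : 'I_n | i < j]).
have -> : [set i : 'I_n | i < j] :&: [set i | p i < p j]
          = [set i : 'I_n | (i < j) && (p i < p j)].
  by apply/setP => i; rewrite !inE.
rewrite addKn; congr #|pred_of_set _|; apply/setP => i; rewrite !inE andbC.
case: (ltnP i j) => [lt_ij|]; last by rewrite !andbF.
(* As i < j, injectivity of [p] rules out a tie, so a value that is not smaller is larger. *)
rewrite !andbT -leqNgt ltn_neqAle andb_idl // => _.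
by rewrite val_eqE (inj_eq perm_inj) -val_eqE gtn_eqF.
Qed.

(** Grouping pairs by their second entry turns both pair counts in [inv_c] into sums over the later
    position, ready to be merged with the color sum. *)
Lemma card_pairs (T : finType) (P : rel T) :
  #|[set ij : T * T | P ij.1 ij.2]| = \sum_j #|[set i | P i j]|.
Proof.
rewrite cardsE -sum1_card [LHS](eq_bigl (fun ij => true && P ij.1 ij.2)) //.
rewrite -(pair_big_dep xpredT P (fun _ _ => 1)) /= (exchange_big_dep xpredT) //=.
by apply: eq_bigr => j _; rewrite sum1dep_card.
Qed.

Lemma smaller_before_inj n (p q : 'S_n) :
  smaller_before p =1 smaller_before q -> p = q.
Proof.
(* Counting values instead of positions lets the counts of two permutations be compared by set
   inclusion. *)
have values (r : 'S_n) j :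
    smaller_before r j = #|[set x : 'I_n | (r^-1%g x < j) && (x < r j)]|.
  rewrite /smaller_before -(card_imset _ (@perm_inj _ r)); congr #|pred_of_set _|.
  apply/setP => x; rewrite -[x in LHS](permKV r).
  by rewrite mem_imset ?inE ?permKV //; exact: perm_inj.
(* If p and q agree after j, the values at positions <= j form the same set;
   p j < q j would then give q strictly more values below the j-th one. *)
have not_lt (r s : 'S_n) (j : 'I_n) : (forall i : 'I_n, j < i -> r i = s i) ->
    smaller_before r j = smaller_before s j -> (r j < s j) = false.
  move=> eq_after eq_card; apply: contra_eqF eq_card => lt_rs.
  rewrite neq_ltn; apply/orP; left; rewrite !values; apply: proper_card.
  (* In [s], the value x cannot sit at j, where the value is larger, nor after j, where [r] and [s]
     agree while [r] has x no later than j. *)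
  have before (x : 'I_n) : r^-1%g x <= j -> x < s j -> s^-1%g x < j.
    move=> le_xj lt_xs; rewrite ltnNge; apply/negP; rewrite leq_eqVlt.
    case/orP => [/eqP/val_inj ejx|lt_jx].
      by move: lt_xs; rewrite ejx permKV ltnn.
    have := eq_after _ lt_jx; rewrite permKV => rx.
    by move: le_xj; rewrite -rx permK leqNgt lt_jx.
  apply/properP; split.
    apply/subsetP => x; rewrite !inE => /andP[lt_xj lt_xr].
    have lt_xs := ltn_trans lt_xr lt_rs.
    by rewrite lt_xs before // ltnW.
  (* The value [r j] is counted for [s] but, not being below itself, not for [r]. *)
  by exists (r j); rewrite !inE ?ltnn ?andbF // lt_rs before // permK.
move=> eq_pq; apply/permP => j.
(* Induction on n - j recovers the values from the last position back to the first. *)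
have [m] := ubnP (n - j); elim: m j => // m IHm j le_m.
have eq_after (i : 'I_n) : j < i -> p i = q i.
  by move=> lt_ji; apply: IHm; have := ltn_ord i; lia.
have not_lt_pq := not_lt p q j eq_after (eq_pq j).
have not_lt_qp := not_lt q p j (fun i lt_ji => esym (eq_after i lt_ji)) (esym (eq_pq j)).
by apply/val_inj/eqP; rewrite eqn_leq leqNgt not_lt_qp leqNgt not_lt_pq.
Qed.

Definition digit (c j a d : nat) : nat := j - a + d + c * (if d != 0 then a else 0).

Lemma digit_lt c j a d : a <= j -> d < c -> digit c j a d < c * j.+1.
Proof. by rewrite /digit; case: d => [|d] /=; nia. Qed.

Lemma digit_inj c j a b d e : a <= j -> b <= j -> d < c -> e < c ->
  digit c j a d = digit c j b e -> a = b /\ d = e.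
Proof.
rewrite /digit; case: d => [|d]; case: e => [|e] /=; try nia.
case: c => // c le_aj le_bj lt_dc lt_ec eq_digit.
(* Both colors are now nonzero, and [c], [d], [e] denote the original numbers less one. The digits
   are j + 1 plus these two sides, and d, e < c, so quotient and remainder by [c] separate them. *)
have eq_base : a * c + d = b * c + e by nia.
have c_gt0 : 0 < c by lia.
have := congr1 (divn^~ c) eq_base; have := congr1 (modn^~ c) eq_base.
rewrite /= !modnMDl !divnMDl // !modn_small // !divn_small // !addn0.
by move=> -> ->.
Qed.

Lemma code_digit_lt c n (s : colored_perm c n) (j : 'I_n) :
  digit c j (smaller_before (underlying s) j) (color s j) < c * j.+1.
Proof. by rewrite digit_lt ?smaller_before_le ?ltn_ord. Qed.

Definition code_of c n (s : colored_perm c n) : lehmer_code c n :=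
  [ffun j : 'I_n => Ordinal (code_digit_lt s j) : 'I_(c * j.+1)].

Lemma code_of_inj c n : injective (@code_of c n).
Proof.
move=> s t eq_st.
have eq_digits j : smaller_before (underlying s) j = smaller_before (underlying t) j
                   /\ color s j = color t j.
  have := congr1 (fun l : lehmer_code c n => val (l j)) eq_st; rewrite !ffunE /=.
  by apply: digit_inj; rewrite ?smaller_before_le // /color ltn_ord.
have eq_perm : s.1 = t.1 by apply: smaller_before_inj => j; case: (eq_digits j).
have eq_col : s.2 = t.2 by apply/ffunP => j; apply: val_inj; case: (eq_digits j).
by rewrite [s]surjective_pairing eq_perm eq_col -surjective_pairing.
Qed.

Lemma perm_invE n (p : 'S_n) : Defs.perm_inv p = \sum_(j < n) (j - smaller_before p j).
Proof.
apply: etrans (card_pairs (fun i j : 'I_n => (i < j) && (p j < p i))) _.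
by apply: eq_bigr => j _; rewrite card_larger_before.
Qed.

Lemma code_sum_code_of c n (s : colored_perm c n) : code_sum (code_of s) = inv_c s.
Proof.
have colored_pairs : #|[set ij : 'I_n * 'I_n | [&& ij.1 < ij.2,
      underlying s ij.1 < underlying s ij.2 & color s ij.2 != 0]]|
    = \sum_(j < n) if color s j != 0 then smaller_before (underlying s) j else 0.
  apply: etrans (card_pairs (fun i j : 'I_n =>
    [&& i < j, underlying s i < underlying s j & color s j != 0])) _.
  apply: eq_bigr => j _; case: (color s j != 0).
    by congr #|pred_of_set _|; apply/setP => i; rewrite !inE andbT.
  by apply/eqP; rewrite cards_eq0; apply/eqP/setP => i; rewrite !inE !andbF.
rewrite /inv_c perm_invE colored_pairs /color_sum big_distrr /= -!big_split /=.
by apply: eq_bigr => j _; rewrite ffunE.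
Qed.

(** The product of the bounds c * (i + 1) is c^n * n!. With this equality, injectivity of [code_of]
    already gives bijectivity, and no inverse has to be built. *)
Lemma card_lehmer_code c n : #|lehmer_code c n| = #|colored_perm c n|.
Proof.
rewrite card_prod card_ffun card_Sn !card_ord card_dep_ffun foldrE big_map.
rewrite big_enum /=.
under eq_bigr do rewrite card_ord.
rewrite big_split /= prod_nat_const card_ord mulnC; congr (_ * _).
by rewrite fact_prod big_add1 big_mkord.
Qed.

Theorem theorem2p2 (n c : nat) (hn : 1 <= n) (hc : 1 <= c) (k : nat) :
  #|[set l : lehmer_code c n | code_sum l == k]| = colored_mahonian c n k.
Proof.
have code_bij : bijective (@code_of c n).
  by apply: inj_card_bij; [exact: code_of_inj | rewrite card_lehmer_code].
rewrite /colored_mahonian -(on_card_preimset (f := @code_of c n)).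
  by congr #|pred_of_set _|; apply/setP => s; rewrite !inE code_sum_code_of.
exact: onW_bij.
Qed.
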